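(* Let $K$ be a field, let $X$ be a set and let $A$ be a ring of functions $X\to K$ containing the constant functions and such that every $f\in A$ without zeroes in $X$ is a unit in $A$. Suppose one of the following conditions holds: (a) $K$ is not algebraically closed; or (b) $K$ is the algebraic closure of a real closed field $R$ and $A$ is closed under the conjugation of $K=R[i]$; or (c) $K$ is a topological field of characteristic $\ne2$, where a basis of neighborhoods of $0\in K$ is given by the non-zero ideals of a ring $\mathcal O$ with fraction field $K$ and non-zero Jacobson radical, and moreover $w\circ(f,g)\in A$ for all $f,g\in A$ and every continuous function $w:K^2\to K$ that is definable in $(K,\mathcal O)$. Then the following conditions are equivalent for all $f_1,\dots,f_n,g\in A$: (1) $\{f_1=0\}\cap\dots\cap\{f_n=0\}\subseteq\{g=0\}$. (2) $g\in\operatorname{Jac}(f_1,\dots,f_n)$. (3) For all $h\in A$, the element $1+hg$ is a unit modulo the ideal $(f_1,\dots,f_n)$. Consequently, the $(n+1)$-ary relation $\{f_1=0\}\cap\dots\cap\{f_n=0\}\subseteq\{g=0\}$ on $A$ is definable in the ring $A$ by the formula of the language of rings $$\forall x\,\exists y_1,\dots,y_n,z\ \ (1+x\cdot g)\cdot z=1+y_1f_1+\dots+y_nf_n.$$ In particular (case $n=1$), the binary relation $f\sqsubseteq g$, defined as $\{f=0\}\subseteq\{g=0\}$, is $0$-definable in $A$.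
   Context: For a function $f:X\to K$, $\{f=0\}=\{x\in X: f(x)=0\}$. A ring of functions $X\to K$ is a (unital) subring of $K^X$ with pointwise operations. For an ideal $I$ of a commutative ring $A$, the Jacobson radical $\operatorname{Jac}(I)$ is the intersection of all maximal ideals of $A$ containing $I$; the Jacobson radical of a ring is $\operatorname{Jac}(0)$; $\operatorname{Jac}(f_1,\dots,f_n)$ denotes $\operatorname{Jac}$ of the ideal generated by $f_1,\dots,f_n$. Closed under conjugation in (b) means that $x\mapsto f(x)^*$ is in $A$ whenever $f\in A$, where $^*$ is the complex conjugation of $R[i]$ over $R$. $(K,\mathcal O)$ is the field $K$ expanded by a predicate for the subset $\mathcal O$; definable means with parameters. *)

(* Defs.v *)
From HB Require Import structures.
From mathcomp Require Import all_boot all_order all_algebra.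
From mathcomp Require Import boolp classical_sets functions filter topology.
Set Implicit Arguments.
Unset Strict Implicit.
Unset Printing Implicit Defensive.
Import GRing.Theory.
Local Open Scope ring_scope.
Local Open Scope classical_set_scope.

Record subring (R : comPzRingType) (S : subringClosed R) := Subring {
  subring_val : R;
  subring_valP : subring_val \in S
}.

Section SubringInstances.
Variables (R : comPzRingType) (S : subringClosed R).
HB.instance Definition _ := [isSub for @subring_val R S].
HB.instance Definition _ := [Choice of subring S by <:].
HB.instance Definition _ :=
  GRing.SubChoice_isSubComPzRing.Build R _ (subring S) (subringClosedP S).
End SubringInstances.

(** Ideals are taken in rings that may be zero, since a ring of functions on the
    empty set is zero. *)

Section Ideals.
Variable R : comPzRingType.
Implicit Types (I M : set R).

Definition is_unit (a : R) := exists b : R, a * b = 1.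

Definition ideal I :=
  [/\ I 0, forall a b, I a -> I b -> I (a + b) & forall a b, I b -> I (a * b)].

Definition maximal_ideal M :=
  [/\ ideal M, M <> setT &
      forall I, ideal I -> M `<=` I -> I = M \/ I = setT].

Definition Jac I : set R :=
  [set a | forall M, maximal_ideal M -> I `<=` M -> M a].

Definition ideal_gen n (f : 'I_n -> R) : set R :=
  [set h | exists a : 'I_n -> R, h = \sum_i a i * f i].

Definition unit_mod I (a : R) := exists b : R, I (a * b - 1).

Definition nonzero_ideal I := ideal I /\ exists2 a, I a & a != 0.

End Ideals.

(** First-order logic over the language of rings [{0, 1, -, +, *}] expanded
    by unary predicate symbols indexed by [P]; [P := void] is the language of
    rings.  A formula in [rformula P n] has its free variables among
    [0, ..., n - 1], and a quantifier binds the last variable, number [n], of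
    its body in [rformula P n.+1]. *)

Inductive rterm (n : nat) : Type :=
| TVar of 'I_n
| TZero
| TOne
| TOpp of rterm n
| TAdd of rterm n & rterm n
| TMul of rterm n & rterm n.

Arguments TZero {n}.
Arguments TOne {n}.

Inductive rformula (P : Type) (n : nat) : Type :=
| FEq of rterm n & rterm n
| FPred of P & rterm n
| FNot of rformula P n
| FAnd of rformula P n & rformula P n
| FOr of rformula P n & rformula P n
| FImp of rformula P n & rformula P n
| FAll of rformula P n.+1
| FEx of rformula P n.+1.

Arguments FEq {P n}.

Definition env_rcons (T : Type) n (v : 'I_n -> T) (a : T) : 'I_n.+1 -> T :=
  fun i => if unlift ord_max i is Some j then v j else a.

Definition env_cat (T : Type) n m (v : 'I_n -> T) (p : 'I_m -> T) :
    'I_(n + m) -> T :=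
  fun i => match fintype.split i with inl j => v j | inr k => p k end.

Section Semantics.
Variables (M : pzRingType) (P : Type) (S : P -> set M).

Fixpoint teval n (v : 'I_n -> M) (t : rterm n) : M :=
  match t with
  | TVar i => v i
  | TZero => 0
  | TOne => 1
  | TOpp s => - teval v s
  | TAdd s u => teval v s + teval v u
  | TMul s u => teval v s * teval v u
  end.

Fixpoint sat n (v : 'I_n -> M) (phi : rformula P n) : Prop :=
  match phi with
  | FEq s t => teval v s = teval v t
  | FPred p t => S p (teval v t)
  | FNot psi => ~ sat v psi
  | FAnd psi chi => sat v psi /\ sat v chi
  | FOr psi chi => sat v psi \/ sat v chi
  | FImp psi chi => sat v psi -> sat v chi
  | FAll psi => forall a : M, sat (env_rcons v a) psi
  | FEx psi => exists a : M, sat (env_rcons v a) psi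
  end.

Definition defines n (phi : rformula P n) (D : set ('I_n -> M)) :=
  forall v, D v <-> sat v phi.

Definition zero_definable n (D : set ('I_n -> M)) :=
  exists phi : rformula P n, defines phi D.

Definition definable n (D : set ('I_n -> M)) :=
  exists m (p : 'I_m -> M) (phi : rformula P (n + m)),
    forall v, D v <-> sat (env_cat v p) phi.

End Semantics.

Definition ring_pred (M : pzRingType) (p : void) : set M :=
  match p with end.

(* interprets the single predicate symbol of the expansion [(K, O)] *)
Definition subset_pred (M : pzRingType) (O : set M) (p : unit) : set M := O.

Definition definable_fun2 (M : pzRingType) (P : Type) (S : P -> set M)
    (w : M * M -> M) :=
  definable S
    [set v : 'I_3 -> M | v (inord 2) = w (v (inord 0), v (inord 1))].

Fixpoint FExs (P : Type) (k n : nat) : rformula P (k + n) -> rformula P n :=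
  match k with
  | 0 => id
  | k'.+1 => fun phi => FExs (FEx phi)
  end.

(* [forall x, exists y_1 ... y_n z,
      (1 + x * g) * z = 1 + y_1 * f_1 + ... + y_n * f_n].
   Variables: [f_1, ..., f_n, g] are [0, ..., n] (free), [x] is [n + 1],
   [y_1, ..., y_n] are [n + 2, ..., 2n + 1], and [z] is [2n + 2]. *)
Definition zero_incl_formula (n : nat) : rformula void n.+1 :=
  let V k : rterm (n.+1 + n.+2) := TVar (inord k) in
  let f i := V i in
  let g := V n in
  let x := V n.+1 in
  let y i := V (n.+2 + i)%N in
  let z := V (n.+2 + n)%N in
  FAll (FExs (k := n.+1)
    (FEq (TMul (TAdd TOne (TMul x g)) z)
         (foldl (fun t i => TAdd t (TMul (y i) (f i))) TOne (iota 0 n)))).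

Definition zeros (X : Type) (K : fieldType) (f : X -> K) : set X :=
  [set x | f x = 0].

Definition algebraically_closed (K : fieldType) := GRing.closed_field_axiom K.

Definition is_algebraic_closure (R K : fieldType) (iota : {rmorphism R -> K}) :=
  algebraically_closed K /\ forall z : K, algebraicOver iota z.

(* [c] is [a + i b |-> a - i b] on [K = R[i]]; the condition does not depend
   on the choice of the square root [i] of [-1] *)
Definition is_conjugation (R K : fieldType) (iota : {rmorphism R -> K})
    (c : K -> K) :=
  forall (i : K) (a b : R), i ^+ 2 = -1 ->
    c (iota a + i * iota b) = iota a - i * iota b.

Definition conj_closed_condition (K : fieldType) (X : Type)
    (A : set (X -> K)) :=
  exists (R : rcfType) (iota : {rmorphism R -> K}) (c : K -> K),
    [/\ is_algebraic_closure iota, is_conjugation iota c &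
        forall f, A f -> A (c \o f)].

(* [top] is a topology on the carrier of [K]; it also packs a choice structure,
   unrelated to that of [K], which plays no role. *)
Definition top_space (K : fieldType) (top : Topological.axioms_ K) :
  topologicalType := Topological.Pack top.

Definition is_topological_field (K : fieldType) (top : Topological.axioms_ K) :=
  let T := top_space top in
  [/\ continuous ((fun z => z.1 + z.2 : K) : T * T -> T),
      continuous ((fun x => - (x : K)) : T -> T),
      continuous ((fun z => z.1 * z.2 : K) : T * T -> T) &
      forall x : K, x != 0 ->
        {for (x : T), continuous ((fun y => (y : K)^-1) : T -> T)}].

Definition is_fraction_field (K : fieldType) (O : subringClosed K) :=
  forall x : K, exists a b : subring O, b != 0 /\ x = val a / val b.

Definition ideal_topology_condition (K : fieldType) (X : Type)
    (A : set (X -> K)) :=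
  2%N \notin [pchar K] /\
  exists (top : Topological.axioms_ K) (O : subringClosed K),
    let T := top_space top in
    [/\ is_topological_field top,
        nbhs ((0 : K) : T) = filter_from (@nonzero_ideal (subring O))
                         (fun I => [set val a | a in I]) :> set (set T),
        is_fraction_field O,
        exists2 a : subring O, Jac [set 0] a & a != 0 &
        forall w : K * K -> K,
          continuous (w : T * T -> T) ->
          definable_fun2 (subset_pred [set x : K | x \in O]) w ->
          forall f g, A f -> A g -> A (fun x => w (f x, g x))].

(* Main.v *)
(** (2) and (3) are equivalent in every commutative ring.  (3) implies (1) on
    taking for [h] the constant [- 1 / g(x)].  For the converse it suffices that
    for all [f, g] in [A] some [a f + b g], with [a, b] in [A], vanishes exactly
    where both [f] and [g] do: by induction the same holds for finitely many
    functions, and applied to [f_1, ..., f_n, 1 + h g], which have no common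
    zero, it gives a unit in the ideal they generate.  In case (a), [a f + b g]
    is an anisotropic binary form in [f, g]; in case (b) it is [f f^* + g g^*].
    In case (c), let [D] be the set of [(x, y)] with [x <> 0] and [y / x] in
    [O].  It is clopen in [K^2] minus the origin because [O] and some proper
    ideal of [O] are neighborhoods of [0].  Hence [w1 = x] on [D], [0] elsewhere,
    and [w2 = 0] on [D], [y] elsewhere, are continuous and definable, and
    [x w1 + y w2] vanishes only at the origin. *)

Require Import Defs.
From HB Require Import structures.
From mathcomp Require Import all_boot all_order all_algebra.
From mathcomp Require Import boolp classical_sets functions filter topology.
From mathcomp Require Import ring.
From mathcomp Require complex.
Set Implicit Arguments.
Unset Strict Implicit.
Unset Printing Implicit Defensive.
Import GRing.Theory.
Local Open Scope ring_scope.
Local Open Scope classical_set_scope.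

(** * Maximal ideals and the Jacobson radical of an ideal *)

Section IdealTheory.
Variable R : comPzRingType.
Implicit Types (I M : set R) (a g : R).

Lemma ideal_full I : ideal I -> I 1 -> I = setT.
Proof.
move=> [_ _ IM] I1; apply/seteqP; split=> // x _.
by rewrite -[x]mulr1; apply: IM.
Qed.

Lemma idealN I a : ideal I -> I a -> I (- a).
Proof. by case=> _ _ IM Ia; rewrite -mulN1r; apply: IM. Qed.

Lemma ideal_gen_ideal n (f : 'I_n -> R) : ideal (ideal_gen f).
Proof.
split.
- by exists (fun=> 0); rewrite big1 // => i _; rewrite mul0r.
- move=> _ _ [a ->] [b ->]; exists (fun i => a i + b i).
  by rewrite -big_split; apply: eq_bigr => i _; rewrite mulrDl.
- move=> c _ [a ->]; exists (fun i => c * a i).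
  by rewrite mulr_sumr; apply: eq_bigr => i _; rewrite mulrA.
Qed.

Lemma ideal_adjoin I a : ideal I ->
  ideal [set x | exists2 b, I b & exists r, x = b + r * a].
Proof.
move=> [I0 ID IM]; split.
- by exists 0 => //; exists 0; rewrite mul0r addr0.
- move=> _ _ [b Ib [r ->]] [c Ic [s ->]]; exists (b + c); first exact: ID.
  by exists (r + s); rewrite mulrDl addrACA.
- move=> c _ [b Ib [r ->]]; exists (c * b); first exact: IM.
  by exists (c * r); rewrite mulrDr mulrA.
Qed.

Lemma ideal_sub_maximal I : ideal I -> ~ I 1 ->
  exists2 M, maximal_ideal M & I `<=` M.
Proof.
move=> idI I1.
(* Zorn's lemma is also applied to the empty chain, whose union is empty. Testing [Y] united with
   [I], instead of [Y], makes that case hold by the hypotheses on [I]. *)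
pose P (Y : set R) := ideal (Y `|` I) /\ ~ (Y `|` I) 1.
have [|Y [[idY Y1] Ymax]] := @Zorn_bigcup R P.
  move=> F FP Ftot; split; last first.
    case=> [[Y FY Y1]|//]; have [_] := FP _ FY; apply; by left.
  case: (idI) => I0 ID IM; split.
  - by right.
  - move=> a b [[Y FY Ya]|Ia] [[Z FZ Zb]|Ib].
    + have [sub|sub] := Ftot _ _ FY FZ.
      * have [[_ ZD _] _] := FP _ FZ.
        case: (ZD a b _ _); [by left; apply: sub|by left| |by right].
        by move=> h; left; exists Z.
      * have [[_ YD _] _] := FP _ FY.
        case: (YD a b _ _); [by left|by left; apply: sub| |by right].
        by move=> h; left; exists Y.
    + have [[_ YD _] _] := FP _ FY.
      case: (YD a b _ _); [by left|by right| |by right].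
      by move=> h; left; exists Y.
    + have [[_ ZD _] _] := FP _ FZ.
      case: (ZD a b _ _); [by right|by left| |by right].
      by move=> h; left; exists Z.
    + by right; apply: ID.
  - move=> a b [[Y FY Yb]|Ib]; last by right; apply: IM.
    have [[_ _ YM] _] := FP _ FY.
    case: (YM a b _); [by left| |by right].
    by move=> h; left; exists Y.
exists (Y `|` I); last exact: subsetUr.
split=> // [M1|J idJ sub]; first by apply: Y1; rewrite M1.
have [J1|J1] := pselect (J 1); first by right; apply: ideal_full.
left; apply/seteqP; split=> // x Jx.
apply: contrapT => nYx; apply: (Ymax J).
  split; first exact: subset_trans (@subsetUl _ _ _) sub.
  by move=> JY; apply: nYx; left; apply: JY.
rewrite /P (_ : J `|` I = J) //.
by apply: setUidl; apply: subset_trans (@subsetUr _ _ _) sub.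
Qed.

(** If [1 + h * g] is not a unit modulo [I], adjoining it to [I] gives a proper ideal; a maximal
    ideal above it contains [g] and [1 + h * g], hence 1. If a maximal [M] above [I] misses [g],
    then [1 = b + r * g] with [b] in [M], and [b = 1 - r * g] is a unit modulo [I], hence modulo
    [M]. *)
Lemma Jac_unit_modP I g : ideal I ->
  Jac I g <-> forall h, unit_mod I (1 + h * g).
Proof.
move=> idI; split=> [Jg h|ug M [idM Mprop Mmax] IM].
- apply: contrapT => nu.
  have [|M Mmax sub] := ideal_sub_maximal (ideal_adjoin (1 + h * g) idI).
    move=> [b Ib [r e]]; apply: nu; exists r.
    rewrite (_ : _ - 1 = - b); first exact: idealN.
    by rewrite [in - 1]e mulrC opprD addrCA subrr addr0.
  have Mg : M g.
    apply: Jg => // x Ix; apply: sub; exists x => //.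
    by exists 0; rewrite mul0r addr0.
  have Mu : M (1 + h * g).
    apply: sub; exists 0; first by case: idI.
    by exists 1; rewrite add0r mul1r.
  have [idM Mprop _] := Mmax; apply: Mprop.
  apply: ideal_full => //; case: (idM) => _ MD MM.
  rewrite -[1](addrK (h * g)); apply: MD => //.
  by apply: idealN => //; apply: MM.
- apply: contrapT => nMg; have [M0 MD MM] := idM.
  have [|e|e] := Mmax _ (ideal_adjoin g idM).
  + by move=> x Mx; exists x => //; exists 0; rewrite mul0r addr0.
  + apply: nMg; rewrite -e; exists 0 => //; exists 1.
    by rewrite add0r mul1r.
  + have [b Mb [r e1]] : [set x | exists2 b, M b & exists r, x = b + r * g] 1.
      by rewrite e.
    have [c /IM Mc] := ug (- r).
    apply: Mprop; apply: ideal_full => //.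
    rewrite -[1](subKr (b * c)); apply: MD; first by rewrite mulrC; apply: MM.
    apply: idealN => //.
    by have -> : b = 1 + - r * g by rewrite e1 mulNr addrK.
Qed.

End IdealTheory.

(** The property to be derived from each of the three conditions. The converse implication is
    automatic, so [a * f + b * g] vanishes exactly at the common zeros. *)
Definition zeros_principal (K : fieldType) (X : Type)
    (A : subringClosed (X -> K)) :=
  forall f g : subring A, exists a b : subring A, forall x,
    val (a * f + b * g) x = 0 -> val f x = 0 /\ val g x = 0.

(** * Common zeros and units modulo an ideal in a ring of functions; case (a) *)

Section RingOfFunctions.
Variables (K : fieldType) (X : Type) (A : subringClosed (X -> K)).
Implicit Types f g : subring A.

Lemma subring_sumE I (r : seq I) (F : I -> subring A) x :
  val (\sum_(i <- r) F i) x = \sum_(i <- r) val (F i) x.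
Proof. exact: (big_morph (fun f => val f x)). Qed.

Lemma subring_exprE f n x : val (f ^+ n) x = val f x ^+ n.
Proof. by elim: n => // n IHn; rewrite !exprS -IHn. Qed.

Hypothesis hconst : forall c : K, (fun=> c) \in A.

Definition const_fun (c : K) : subring A := Subring (hconst c).

(* With [x ^ n - sum_i P_i x ^ i] without roots, the form
   [x ^ n - sum_i P_i x ^ i y ^ (n - i)] vanishes only at the origin. *)
Lemma zeros_principal_not_closed :
  ~ algebraically_closed K -> zeros_principal A.
Proof.
move=> ncl; suff [n [P [n0 noroot]]] : exists n (P : nat -> K), (0 < n)%N /\
    forall x, x ^+ n != \sum_(i < n) P i * x ^+ i.
  move=> f g; exists (f ^+ n.-1).
  (* Since [i < n], each term of the form after [f ^+ n] has a factor [g]; one is split off to leave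
     a multiplier of [g]. *)
  exists (- \sum_(i < n) const_fun (P i) * f ^+ i * g ^+ (n - i).-1) => x.
  set u := val f x; set v := val g x => h.
  have {h} : u ^+ n = \sum_(i < n) P i * u ^+ i * v ^+ (n - i).
    move: h => /eqP; rewrite addrC mulNr addr_eq0 eqr_opp eq_sym => /eqP h.
    transitivity (val (f ^+ n.-1 * f) x).
      by rewrite -exprSr prednK // subring_exprE.
    transitivity (val ((\sum_(i < n) const_fun (P i) * f ^+ i *
      g ^+ (n - i).-1) * g) x) => //.
    rewrite mulr_suml subring_sumE; apply: eq_bigr => i _.
    rewrite -mulrA -exprSr prednK ?subn_gt0 ?ltn_ord //.
    by rewrite -2!subring_exprE.
  have [->|v0] := eqVneq v 0.
    rewrite big1 => [/eqP|i _]; last first.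
      by rewrite expr0n subn_eq0 leqNgt ltn_ord mulr0.
    by rewrite expf_eq0 n0 => /eqP.
  move=> h; exfalso; move: (noroot (u / v)) => /eqP; apply.
  rewrite expr_div_n h mulr_suml; apply: eq_bigr => i _.
  rewrite expr_div_n -!mulrA; congr (_ * (_ * _)).
  rewrite -[X in v ^- X](subnK (ltnW (ltn_ord i))) exprD invfM mulrA.
  by rewrite divff ?mul1r // expf_neq0.
apply: contrapT => h; apply: ncl => n P n0.
apply: contrapT => nx; apply: h; exists n, P; split=> // x.
by apply/eqP => e; apply: nx; exists x.
Qed.

Hypothesis hunit : forall f, (forall x, val f x != 0) -> is_unit f.
Hypothesis hprinc : zeros_principal A.

Lemma zeros_principal_seq n (f : 'I_n -> subring A) :
  exists a : 'I_n -> subring A, forall x,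
    val (\sum_i a i * f i) x = 0 -> forall i, val (f i) x = 0.
Proof.
elim: n f => [|n IHn] f; first by exists (fun=> 0) => x _ [].
have [a ha] := IHn (fun i => f (lift ord0 i)).
have [b [c hbc]] := hprinc (f ord0) (\sum_i a i * f (lift ord0 i)).
exists (fun i => if unlift ord0 i is Some j then c * a j else b) => x.
rewrite big_ord_recl unlift_none.
rewrite (_ : \sum_(i < n) _ = c * \sum_i a i * f (lift ord0 i)).
  move=> /hbc[h0 /ha h] i; case: (unliftP ord0 i) => [j ->|->] //.
rewrite mulr_sumr; apply: eq_bigr => i _; by rewrite liftK mulrA.
Qed.

Lemma zeros_unit_mod n (f : 'I_n -> subring A) g :
  \bigcap_i zeros (val (f i)) `<=` zeros (val g) <->
  forall h, unit_mod (ideal_gen f) (1 + h * g).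
Proof.
split=> [sub h|um x fx].
- have [a ha] := zeros_principal_seq f.
  have [b [c hbc]] := hprinc (\sum_i a i * f i) (1 + h * g).
  have [|s hs] := hunit (f := b * (\sum_i a i * f i) + c * (1 + h * g)).
    move=> x; apply/eqP => /hbc [/ha fx].
    have gx : val g x = 0 by apply: sub => i _; exact: fx.
    have -> : val (1 + h * g) x = 1 + val h x * val g x by [].
    by rewrite gx mulr0 addr0 => /eqP; rewrite oner_eq0.
  (* With [F] the combination of the [f i], [(b * F + c * (1 + h * g)) * s = 1]; so [c * s] inverts
     [1 + h * g] up to the multiple [- (b * s) * F]. *)
  exists (c * s); rewrite -[X in _ - X]hs.
  rewrite (_ : _ - _ = - (b * s) * (\sum_i a i * f i)).
    by have [_ _ IM] := ideal_gen_ideal f; apply: IM; exists a.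
  by rewrite [(b * _ + _) * s]mulrDl opprD mulrCA mulrA [LHS]addrC subrK mulNr mulrAC.
- apply: contrapT => /eqP gx; have [b [a]] := um (const_fun (- (val g x)^-1)).
  move=> /(congr1 (fun u => val u x)); rewrite subring_sumE big1 => [|i _].
    have -> : val ((1 + const_fun (- (val g x)^-1) * g) * b - 1) x =
      (1 + - (val g x)^-1 * val g x) * val b x - 1 by [].
    rewrite mulNr mulVf // subrr mul0r sub0r => /eqP.
    by rewrite oppr_eq0 oner_eq0.
  have -> : val (a i * f i) x = val (a i) x * val (f i) x by [].
  by rewrite (fx i) // mulr0.
Qed.

End RingOfFunctions.

(** * Case (b): algebraic closure of a real closed field *)

Section RealClosed.
Import complex.
Variables (R : rcfType) (K : fieldType) (iota : {rmorphism R -> K}) (i : K).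
Hypothesis i2 : i ^+ 2 = -1.

(** A ring morphism because [i ^+ 2 = -1]; it carries factorizations over the algebraically closed
    field [complex R] into [K]. *)
Definition complex_embed (z : complex R) : K := iota (Re z) + i * iota (Im z).

Lemma complex_embed_zmod : zmod_morphism complex_embed.
Proof.
move=> [a b] [c d].
have -> : Complex a b - Complex c d = Complex (a - c) (b - d) by [].
by rewrite /complex_embed /= !rmorphB; ring.
Qed.

Lemma complex_embed_monoid : monoid_morphism complex_embed.
Proof.
split; first by rewrite /complex_embed /= rmorph1 rmorph0 mulr0 addr0.
move=> [a b] [c d].
have -> : Complex a b * Complex c d = Complex (a * c - b * d) (a * d + b * c).
  by [].
rewrite /complex_embed /= rmorphB rmorphD !rmorphM.
have -> : (iota a + i * iota b) * (iota c + i * iota d) =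
  iota a * iota c + i ^+ 2 * (iota b * iota d) +
  i * (iota a * iota d + iota b * iota c) by ring.
rewrite i2. ring.
Qed.

HB.instance Definition _ :=
  GRing.isZmodMorphism.Build _ _ complex_embed complex_embed_zmod.
HB.instance Definition _ :=
  GRing.isMonoidMorphism.Build _ _ complex_embed complex_embed_monoid.

(* A polynomial over [R] splits over [R[i]], so its roots in [K] lie in
   the image of [R[i]]. *)
Lemma algebraic_complex z :
  algebraicOver iota z -> exists a b, z = iota a + i * iota b.
Proof.
move=> [p p0 pz]; pose q := map_poly (real_complex R) p.
have [r qE] := closed_field_poly_normal q.
have : root (map_poly complex_embed q) z.
  rewrite -map_poly_comp (_ : map_poly _ p = map_poly iota p) //.
  apply: eq_map_poly => a.
  by rewrite /= /complex_embed /= rmorph0 mulr0 addr0.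
rewrite qE linearZ_LR /= rootZ; last first.
  by rewrite fmorph_eq0 lead_coef_eq0 map_poly_eq0.
rewrite rmorph_prod rootE horner_prod prodf_seq_eq0 => /hasP [[a b] _] /=.
rewrite rmorphB /= map_polyX map_polyC /= hornerXsubC subr_eq0 => /eqP ->.
by exists a, b.
Qed.

End RealClosed.

Lemma zeros_principal_conj (K : fieldType) (X : Type)
    (A : subringClosed (X -> K)) :
  conj_closed_condition [set f | f \in A] -> zeros_principal A.
Proof.
move=> [R [iota [c [[acl alg] hc Ac]]]] f g.
have [i i2] : exists i : K, i ^+ 2 = -1.
  (* The coefficients -1 and 0 turn the axiom in degree 2 into [i ^+ 2 = -1]. *)
  have [i] := acl 2 (fun j => if j == 0%N then -1 else 0) isT.
  rewrite !big_ord_recl big_ord0 /= mul0r !addr0 mulr1 => h.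
  by exists i.
(* For [z = a + i b] the product [z * c z] is [a ^+ 2 + b ^+ 2], a sum of squares in [R]:
   nonnegative, and zero only if [a = b = 0]. *)
have norm z : exists2 r : R, (0 <= r)%R & z * c z = iota r /\ (r = 0 -> z = 0).
  have [a [b ->]] := algebraic_complex i2 (alg z).
  exists (a ^+ 2 + b ^+ 2); first by rewrite Num.Theory.addr_ge0 ?Num.Theory.sqr_ge0.
  split.
    rewrite hc // rmorphD !rmorphXn /=.
    have -> : (iota a + i * iota b) * (iota a - i * iota b) =
      iota a ^+ 2 - i ^+ 2 * iota b ^+ 2 by ring.
    by rewrite i2; ring.
  move=> /eqP; rewrite Num.Theory.paddr_eq0 ?Num.Theory.sqr_ge0 //.
  rewrite !sqrf_eq0 => /andP [/eqP -> /eqP ->].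
  by rewrite rmorph0 mulr0 addr0.
exists (Subring (Ac _ (valP f))), (Subring (Ac _ (valP g))) => x.
set u := val f x; set v := val g x => h.
have {h} : u * c u + v * c v = 0 by rewrite -h [u * _]mulrC [v * _]mulrC.
have [r r0 [-> ru]] := norm u; have [s s0 [-> sv]] := norm v.
move=> /eqP; rewrite -rmorphD fmorph_eq0 Num.Theory.paddr_eq0 //.
by move=> /andP [/eqP /ru -> /eqP /sv ->].
Qed.

(** * Case (c): local constancy and continuity *)

(** Near a point other than [z0] only one branch occurs. At [z0] both branches take the value
    [p z0], which is why it is the default, and [p] is continuous there. *)
Lemma continuous_if_locally_constant (T U : topologicalType) (D : set T)
    (p : T -> U) (z0 : T) :
  continuous p ->
  (forall z, z <> z0 -> \forall z' \near z, D z' <-> D z) ->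
  continuous (fun z => if `[<D z>] then p z else p z0).
Proof.
move=> pc Dlc z V; case: (pselect (z = z0)) => [-> nV|/Dlc nD].
  have {}nV : nbhs (p z0) V by case: asboolP nV.
  have pV : nbhs z0 (p @^-1` V) := pc z0 V nV.
  change (nbhs z0 [set z' | V (if `[<D z'>] then p z' else p z0)]).
  apply: filterS pV => z' Vz' /=.
  by case: asboolP => // _; exact: (nbhs_singleton nV).
have [Dz|nDz] := asboolP (D z) => nV.
  have pV : nbhs z (p @^-1` V) := pc z V nV.
  change (nbhs z [set z' | V (if `[<D z'>] then p z' else p z0)]).
  apply: filterS2 nD pV => z' DD Vz' /=.
  by rewrite asboolT //; apply/DD.
change (nbhs z [set z' | V (if `[<D z'>] then p z' else p z0)]).
  apply: filterS nD => z' DD /=.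
by rewrite asboolF; [exact: (nbhs_singleton nV) | move=> /DD].
Qed.

Section LocallyConstant.
Variables (K : fieldType) (top : Topological.axioms_ K).
Let T := top_space top.
Hypothesis Ktop : is_topological_field top.
Variables (O : subringClosed K) (a : K).
Hypothesis nbhsO : nbhs ((0 : K) : T) [set x | x \in O].
Hypothesis nbhsJ : nbhs ((0 : K) : T) [set x | exists2 s, s \in O & x = a * s].
Hypothesis aNunit : forall s, s \in O -> a * s != 1.

Lemma nbhs_translate (y : K) (V : set K) : nbhs ((0 : K) : T) V ->
  nbhs (y : T) [set t : T | V ((t : K) - y)].
Proof.
move=> nV; have [addc _ _ _] := Ktop.
have := addc ((y, - y) : T * T) V; rewrite /= subrr => /(_ nV) h.
have cv : ((t, (- y : T)) @[t --> (y : T)] --> ((y, - y) : T * T)).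
  by apply: cvg_pair; [exact: cvg_id|exact: cvg_cst].
exact: (cv _ h).
Qed.

Lemma cvg_mul (F : set_system (T * T)) (p q : T * T -> T) (x y : T) :
  Filter F -> p @ F --> x -> q @ F --> y ->
  (fun z => (p z : K) * (q z : K) : T) @ F --> ((x : K) * (y : K) : T).
Proof.
move=> FF px qy; have [_ _ mulc _] := Ktop.
have pq : (p z, q z) @[z --> F] --> ((x, y) : T * T) by exact: cvg_pair.
by move=> V /(mulc (x, y)) /pq.
Qed.

Lemma cvg_inv (F : set_system (T * T)) (p : T * T -> T) (x : T) :
  Filter F -> (x : K) != 0 -> p @ F --> x ->
  (fun z => (p z : K)^-1 : T) @ F --> ((x : K)^-1 : T).
Proof.
move=> FF x0 px; have [_ _ _ invc] := Ktop.
by move=> V /(invc x x0) /px.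
Qed.

(** Along [F], [p z / x - 1] ends up in the multiples of [a] by elements of [O]. These omit -1, the
    value at [p z = 0], by [aNunit]. *)
Lemma near_neq0 (F : set_system (T * T)) (p : T * T -> T) (x : T) :
  Filter F -> (x : K) != 0 -> p @ F --> x -> \forall z \near F, (p z : K) != 0.
Proof.
move=> FF x0 px.
have cx : ((x : K)^-1 : T) @[_ --> F] --> ((x : K)^-1 : T) by exact: cvg_cst.
have := cvg_mul FF px cx; rewrite mulfV // => cm.
have nearJ : \forall z \near F, exists2 s, s \in O & (p z : K) / x - 1 = a * s.
  exact: (cm _ (nbhs_translate 1 nbhsJ)).
apply: filterS nearJ => z /= [s sO e]; apply/eqP => pz; move: e.
rewrite pz mul0r sub0r => e.
by have := aNunit (rpredNr sO); rewrite mulrN -e opprK eqxx.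
Qed.

Definition quotient_in : set (T * T) :=
  [set z | (z.1 : K) != 0 /\ (z.2 : K) / (z.1 : K) \in O].

(* Near [(x, y)] with [x <> 0] the quotient moves by elements of [O]; near
   [(0, y)] with [y <> 0], [x / y] is a multiple of the non-unit [a] of [O],
   so that [y / x] is not in [O]. *)
Lemma quotient_in_locally_constant (z : T * T) :
  z <> ((0 : K) : T, (0 : K) : T) ->
  \forall z' \near z, quotient_in z' <-> quotient_in z.
Proof.
case: z => x y nz; have Fz : Filter (nbhs ((x, y) : T * T)) by apply: nbhs_filter.
have cx : (@fst T T) @ ((x, y) : T * T) --> x by exact: cvg_fst.
have cy : (@snd T T) @ ((x, y) : T * T) --> y by exact: cvg_snd.
have [x0|x0] := eqVneq (x : K) 0.
- have y0 : (y : K) != 0 by apply/eqP => y0; apply: nz; rewrite x0 y0.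
  have xy0 : (x : K) / (y : K) = 0 by rewrite x0 mul0r.
  have := cvg_mul Fz cx (cvg_inv Fz y0 cy); rewrite xy0 => cm.
  have nearJ : \forall z \near (x, y), exists2 s, s \in O &
      (z.1 : K) / (z.2 : K) = a * s by exact: (cm _ nbhsJ).
  apply: filterS2 (near_neq0 Fz y0 cy) nearJ => -[x' y'] /= y0' [s sO e].
  split=> [[/= x0' q]|[/=]]; last by rewrite x0 eqxx.
  (* The quotient [y' / x'] in [O] would be inverse to [x' / y' = a * s]. *)
  by have := aNunit (rpredM sO q); rewrite mulrA -e mulrA divfK // divff // eqxx.
- have cm := cvg_mul Fz cy (cvg_inv Fz x0 cx).
  have nearO : \forall z \near (x, y),
      (z.2 : K) / (z.1 : K) - (y : K) / (x : K) \in O.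
    exact: (cm _ (nbhs_translate _ nbhsO)).
  apply: filterS2 (near_neq0 Fz x0 cx) nearO => -[x' y'] /= x0' d.
  split=> -[/= _ q]; split=> //=.
    by rewrite -[_ / _](subKr ((y' : K) / (x' : K))) rpredB.
  by rewrite -[_ / _](subrK ((y : K) / (x : K))) rpredD.
Qed.

End LocallyConstant.

(** * Satisfaction of the defining formula *)

Lemma env_rcons_old (T : Type) n (v : 'I_n -> T) a (i : 'I_n) (j : 'I_n.+1) :
  i = j :> nat -> env_rcons v a j = v i.
Proof.
move=> e; rewrite /env_rcons.
have -> : j = lift ord_max i by apply: ord_inj; rewrite lift_max.
by rewrite liftK.
Qed.

Lemma env_rcons_last (T : Type) n (v : 'I_n -> T) a (j : 'I_n.+1) :
  n = j :> nat -> env_rcons v a j = a.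
Proof.
move=> e; rewrite /env_rcons.
have -> : j = ord_max by apply: val_inj.
by rewrite unlift_none.
Qed.

Section Satisfaction.
Variables (M : pzRingType) (P : Type) (S : P -> set M).

(** A block of quantifiers amounts to one extension [w] of [v], as each quantifier appends its
    variable after the old ones. The induction on [k] splits off the last value of [w]. *)
Lemma sat_FExs k n (v : 'I_n -> M) (phi : rformula P (k + n)) :
  sat S v (FExs phi) <->
  exists2 w : 'I_(k + n) -> M,
    forall (i : 'I_n) (j : 'I_(k + n)), i = j :> nat -> w j = v i &
    sat S w phi.
Proof.
elim: k phi => [|k IHk] phi /=.
  split=> [h|[w hw]]; first by exists v => // i j /val_inj ->.
  by rewrite (_ : w = v) //; apply/funext => i; apply: hw.
rewrite IHk; split=> [[w hw [b hb]]|[w hw hb]].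
- exists (env_rcons w b) => // i j e.
  have ltj : (i < k + n)%N by apply: leq_trans (ltn_ord i) (leq_addl _ _).
  rewrite (@env_rcons_old _ _ w b (Ordinal ltj)) //; exact: hw.
- exists (fun j => w (lift ord_max j)).
    by move=> i j e; apply: hw; rewrite lift_max.
  exists (w ord_max); rewrite (_ : env_rcons _ _ = w) //.
  apply/funext => j; rewrite /env_rcons.
  by case: unliftP => [j' ->|->].
Qed.

Lemma teval_foldl n (w : 'I_n -> M) (F : nat -> rterm n) t r :
  teval w (foldl (fun t i => TAdd t (F i)) t r) =
  teval w t + \sum_(i <- r) teval w (F i).
Proof.
elim: r t => [|i r IHr] t /=; first by rewrite big_nil addr0.
by rewrite IHr big_cons /= addrA.
Qed.

End Satisfaction.

(** The value of [z] is an inverse of [1 + h * g] modulo the ideal, and the values of the [y_i] are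
    the coefficients of [(1 + h * g) * z - 1]. *)
Lemma sat_zero_incl_formula (R : comPzRingType) n (f : 'I_n -> R) (g : R) :
  sat (@ring_pred R) (env_rcons f g) (zero_incl_formula n) <->
  forall h, unit_mod (ideal_gen f) (1 + h * g).
Proof.
pose env h := env_rcons (env_rcons f g) h.
have envf h (i : 'I_n) (j : 'I_n.+2) : i = j :> nat -> env h j = f i.
  move=> e; rewrite /env (@env_rcons_old _ _ _ _ (widen_ord (leqnSn n) i)) //.
  exact: env_rcons_old.
have envg h (j : 'I_n.+2) : n = j :> nat -> env h j = g.
  by move=> e; rewrite /env (@env_rcons_old _ _ _ _ ord_max) // env_rcons_last.
have envh h (j : 'I_n.+2) : n.+1 = j :> nat -> env h j = h.
  by move=> e; rewrite /env env_rcons_last.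
have lt2 k : (k < n.+2)%N -> (k < n.+1 + n.+2)%N.
  by move=> h; apply: leq_trans h (leq_addl _ _).
have ltn2 k : (k <= n)%N -> (n.+2 + k < n.+1 + n.+2)%N.
  by move=> h; rewrite addnC ltn_add2r.
pose V k : rterm (n.+1 + n.+2) := TVar (inord k).
pose body : rformula void (n.+1 + n.+2) :=
  FEq (TMul (TAdd TOne (TMul (V n.+1) (V n))) (V (n.+2 + n)%N))
    (foldl (fun t i => TAdd t (TMul (V (n.+2 + i)%N) (V i))) TOne (iota 0 n)).
have bodyP h w :
  (forall (i : 'I_n.+2) (j : 'I_(n.+1 + n.+2)), i = j :> nat -> w j = env h i) ->
  sat (@ring_pred R) w body <->
  (1 + h * g) * w (inord (n.+2 + n)%N) =
    1 + \sum_(i < n) w (inord (n.+2 + i)%N) * f i.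
  move=> hw /=; rewrite teval_foldl /=.
  have wold k (lek : (k < n.+2)%N) : w (inord k) = env h (Ordinal lek).
    by apply: hw; rewrite inordK ?lt2.
  rewrite (wold n.+1) // envh // (wold n) // envg //.
  rewrite -[in iota _ _](subn0 n) big_mkord.
  suff -> : \sum_(i < n) w (inord (n.+2 + i)) * w (inord i) =
            \sum_(i < n) w (inord (n.+2 + i)) * f i by [].
  apply: eq_bigr => i _; have ltin : (i < n.+2)%N by rewrite ltnW // ltnW // !ltnS.
  by rewrite (wold i ltin) (@envf h i).
change ((forall h, sat (@ring_pred R) (env h) (FExs (k := n.+1) body)) <->
  forall h, unit_mod (ideal_gen f) (1 + h * g)).
split=> [h x|um h].
- have /sat_FExs [w hw /(bodyP _ _ hw) e] := h x.
  exists (w (inord (n.+2 + n)%N)).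
  by rewrite e [1 + _]addrC addrK; exists (fun i => w (inord (n.+2 + i)%N)).
- have [z [y e]] := um h; apply/sat_FExs.
  (* The first [n.+2] places hold the [f i], [g] and [h], the next [n] the coefficients; at the last
     place [insub] fails and gives [z]. *)
  pose w (j : 'I_(n.+1 + n.+2)) :=
    if (j < n.+2)%N then env h (inord j)
    else if insub (j - n.+2)%N is Some k then y k else z.
  have hw (i : 'I_n.+2) (j : 'I_(n.+1 + n.+2)) : i = j :> nat -> w j = env h i.
    by move=> ij; rewrite /w -ij ltn_ord inord_val.
  exists w => //; apply/(bodyP _ _ hw).
  have -> : w (inord (n.+2 + n)%N) = z.
    rewrite /w inordK ?ltn2 // ltnNge leq_addr /= addKn.
    by rewrite insubF // ltnn.
  rewrite -[LHS](subrK 1) e addrC; congr (_ + _); apply: eq_bigr => i _.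
  rewrite /w (inordK (ltn2 _ (ltnW (ltn_ord i)))) ltnNge leq_addr /= addKn.
  by rewrite valK.
Qed.

(** * Definability in the expansion of [K] by [O] *)

Section QuotientFormula.
Variables (K : fieldType) (O : set K).

Lemma env_cat0 (T : Type) (v : 'I_3 -> T) (p : 'I_0 -> T) :
  env_cat v p = v :> ('I_3 -> T).
Proof.
apply/funext => i; rewrite /env_cat.
case: splitP => [j e|[]//]; congr v.
by apply: val_inj; rewrite /= e.
Qed.

(** The language has no division, so the quotient is a quantified element of [O], variable 3.
    Variables 0 and 1 are the coordinates; variable 2 is kept for the value of a function. *)
Definition quotient_formula : rformula unit 3 :=
  FAnd (FNot (FEq (TVar (inord 0)) TZero))
    (FEx (FAnd (FPred tt (TVar (inord 3)))
      (FEq (TMul (TVar (inord 3)) (TVar (inord 0))) (TVar (inord 1))))).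

Lemma sat_quotient_formula (v : 'I_3 -> K) :
  sat (subset_pred O) v quotient_formula <->
  v (inord 0) != 0 /\ O (v (inord 1) / v (inord 0)).
Proof.
rewrite /quotient_formula /=.
have old q k (lek : (k < 3)%N) :
    env_rcons v q (inord k : 'I_4) = v (inord k : 'I_3).
  by apply: env_rcons_old; rewrite !inordK // ltnW.
have last q : env_rcons v q (inord 3 : 'I_4) = q.
  by apply: env_rcons_last; rewrite inordK.
split=> [[/eqP v0 [q]]|[v0 q]]; first rewrite last !old //.
  by rewrite /subset_pred => -[Oq <-]; rewrite mulfK.
split; first exact/eqP.
exists (v (inord 1) / v (inord 0)); rewrite last !old //; split=> //.
by rewrite divfK.
Qed.

Lemma definable_if (phi : rformula unit 3) (s t : rterm 3) (w : K * K -> K) :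
  (forall v : 'I_3 -> K, w (v (inord 0), v (inord 1)) =
     if `[<sat (subset_pred O) v phi>] then teval v s else teval v t) ->
  definable_fun2 (subset_pred O) w.
Proof.
move=> hw; exists 0, (fun=> 0).
exists (FOr (FAnd phi (FEq (TVar (inord 2)) s))
            (FAnd (FNot phi) (FEq (TVar (inord 2)) t))) => v.
rewrite env_cat0 /= hw; case: asboolP => h.
  by split=> [->|[[]|[]]//]; left.
by split=> [->|[[]|[]]//]; right.
Qed.

End QuotientFormula.

(** * Case (c): the two continuous definable functions *)

(** As [a != 0], the ring is nonzero and has a maximal ideal; it contains [a], so [a * s = 1] would
    make it improper. *)
Lemma Jac0_not_unit (R : comPzRingType) (a s : R) :
  a != 0 -> Jac [set 0] a -> a * s != 1.
Proof.
move=> a0 Ja; apply/eqP => as1.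
have [| |M Mmax _] := @ideal_sub_maximal R [set 0].
- split=> [//|x y -> ->|x y ->]; by rewrite ?addr0 ?mulr0.
- by move=> /= e; move: a0; rewrite -[a]mulr1 e mulr0 eqxx.
have [idM Mprop _] := Mmax; apply: Mprop; apply: ideal_full => //.
rewrite -as1 mulrC; have [M0 _ MM] := idM.
by apply: MM; apply: Ja => // x ->.
Qed.

Lemma zeros_principal_topology (K : fieldType) (X : Type)
    (A : subringClosed (X -> K)) :
  ideal_topology_condition [set f | f \in A] -> zeros_principal A.
Proof.
move=> [_ [top [O [Ktop nbhs0 _ [a Ja a0] Aw]]]] f g.
have nbhsO : nbhs ((0 : K) : top_space top) [set x | x \in O].
  (* [O] is the unit ideal, nonzero because it contains [a]. *)
  rewrite nbhs0; exists setT; last by move=> _ [b _ <-]; exact: valP.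
  by split=> //; exists a.
have nbhsJ : nbhs ((0 : K) : top_space top)
    [set x | exists2 s, s \in O & x = val a * s].
  rewrite nbhs0; exists [set b | exists s, b = a * s]; last first.
    by move=> _ [_ [s ->] <-]; exists (val s) => //; exact: valP.
  split; last by exists a => //; exists 1; rewrite mulr1.
  split.
  - by exists 0; rewrite mulr0.
  - by move=> _ _ [s ->] [t ->]; exists (s + t); rewrite mulrDr.
  - by move=> b _ [s ->]; exists (b * s); rewrite mulrCA.
have aNunit s : s \in O -> val a * s != 1.
  move=> sO; apply/eqP => e; have /eqP := @Jac0_not_unit _ a (Subring sO) a0 Ja.
  by apply; apply: val_inj.
pose D := quotient_in O (top := top).
have Dlc := quotient_in_locally_constant Ktop nbhsO nbhsJ aNunit.
have DP (v : 'I_3 -> K) : D (v (inord 0), v (inord 1)) <->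
    sat (subset_pred [set x | x \in O]) v quotient_formula.
  by apply: iff_sym; exact: sat_quotient_formula.
pose w1 (z : K * K) : K := if `[<D z>] then z.1 else 0.
pose w2 (z : K * K) : K := if `[<~ D z>] then z.2 else 0.
have w1A : (fun x => w1 (val f x, val g x)) \in A.
  apply: (Aw w1); [|  | exact: valP | exact: valP].
  - exact: (@continuous_if_locally_constant _ _ D fst (0, 0)
      (fun=> cvg_fst) Dlc).
  - apply: (definable_if (phi := quotient_formula)
      (s := TVar (inord 0)) (t := TZero)) => v.
    by rewrite /w1 (asbool_equiv_eq (DP v)).
have w2A : (fun x => w2 (val f x, val g x)) \in A.
  apply: (Aw w2); [|  | exact: valP | exact: valP].
  - apply: (@continuous_if_locally_constant _ _ (fun z => ~ D z) snd (0, 0)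
      (fun=> cvg_snd)) => z /Dlc.
    by apply: filterS => z' DD; split=> h /DD.
  - apply: (definable_if (phi := FNot quotient_formula)
      (s := TVar (inord 1)) (t := TZero)) => v.
    by rewrite /w2 (asbool_equiv_eq (not_iff_compat (DP v))).
exists (Subring w1A), (Subring w2A) => x.
set u := val f x; set v := val g x => h.
have {h} : w1 (u, v) * u + w2 (u, v) * v = 0 by [].
(* On [D] the combination is [u * u] with [u != 0]. Off [D] it is [v * v], so [v = 0]; then [u != 0]
   would put [(u, v)] in [D], as [0 / u = 0] lies in [O]. *)
rewrite /w1 /w2 /=; case: asboolP => Duv.
  rewrite asboolF; last by apply.
  rewrite mul0r addr0 => /eqP; rewrite mulf_eq0 orbb => u0.
  by case: Duv; rewrite /= u0.
rewrite asboolT // mul0r add0r => /eqP; rewrite mulf_eq0 orbb => /eqP v0.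
split=> //; apply: contrapT => /eqP u0; apply: Duv; split=> //=.
by rewrite v0 mul0r rpred0.
Qed.

Theorem theorem3p4 (K : fieldType) (X : Type) (A : subringClosed (X -> K))
  (hconst : forall c : K, (fun=> c) \in A)
  (hunit : forall f : subring A, (forall x : X, val f x != 0) -> is_unit f)
  (hcond : ~ algebraically_closed K
           \/ conj_closed_condition [set f | f \in A]
           \/ ideal_topology_condition [set f | f \in A]) :
  [/\ forall (n : nat) (f : 'I_n -> subring A) (g : subring A),
        [<-> \bigcap_i zeros (val (f i)) `<=` zeros (val g);
             Jac (ideal_gen f) g;
             forall h : subring A, unit_mod (ideal_gen f) (1 + h * g)],
      forall (n : nat) (f : 'I_n -> subring A) (g : subring A),
        \bigcap_i zeros (val (f i)) `<=` zeros (val g) <->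
        sat (@ring_pred (subring A)) (env_rcons f g) (zero_incl_formula n) &
      zero_definable (@ring_pred (subring A))
        [set v : 'I_2 -> subring A |
          zeros (val (v (inord 0))) `<=` zeros (val (v (inord 1)))]].
Proof.
have princ : zeros_principal A.
  case: hcond => [|[|]]; [exact: zeros_principal_not_closed
    | exact: zeros_principal_conj | exact: zeros_principal_topology].
have zerosP n (f : 'I_n -> subring A) g :=
  zeros_unit_mod hconst hunit princ f g.
have satP n (f : 'I_n -> subring A) g :
    \bigcap_i zeros (val (f i)) `<=` zeros (val g) <->
    sat (@ring_pred (subring A)) (env_rcons f g) (zero_incl_formula n).
  by rewrite zerosP; apply: iff_sym; exact: sat_zero_incl_formula.
split=> // [n f g|].
- have JacP := Jac_unit_modP g (ideal_gen_ideal f).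
  by tfae=> [/zerosP /JacP|/JacP|/zerosP].
- exists (zero_incl_formula 1) => v.
  (* A pair is a family of one function followed by [g], and the intersection over ['I_1] is a
     single zero set. *)
  have {2}-> : v = env_rcons (fun=> v (inord 0)) (v (inord 1)).
    apply/funext => i; rewrite /env_rcons.
    case: unliftP => [j ->|->]; congr v; apply: ord_inj.
      by rewrite lift_max inordK // (ord1 j).
    by rewrite inordK.
  rewrite -satP; split=> [sub x h|sub x h]; apply: sub.
    exact: (h ord0).
  by move=> i _.
Qed.
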